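(* Let $K$ be a field and let $M$ be the Chinese monoid of rank $n\ge3$. Every prime ideal $P$ of $K[M]$ contains one of the $2n-3$ ideals of $\heartsuit$ type (for some $s\in\{2,\dots,n-1\}$) or of $\diamondsuit$ type (for some $s\in\{2,\dots,n\}$).
   Context: The Chinese monoid of rank $n$ is the monoid $M=\langle a_1,\dots,a_n\rangle$ defined by the relations $a_ja_ia_k=a_ja_ka_i=a_ka_ja_i$ for $i\le k\le j$; $K[M]$ is its monoid algebra over $K$. For $s\in\{2,\dots,n-1\}$, the ideal of $\heartsuit$ type is the ideal of $K[M]$ generated by the elements $a_ma_i-a_ia_m$ for $m,i\ge s$ and $a_la_m-a_ma_l$ for $l,m\le s$. For $s\in\{2,\dots,n\}$, the ideal of $\diamondsuit$ type is the ideal of $K[M]$ generated by the elements $a_ma_i-a_ia_m$ and $a_ia_{s-1}a_m-a_ma_{s-1}a_i$ for $m,i\ge s$, together with $a_la_m-a_ma_l$ and $a_la_sa_m-a_ma_sa_l$ for $l,m\le s-1$. *)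

(* Defs.v *)
(* MathComp, with classical sets from mathcomp-classical and the monoid algebra
   [{malg K[M]}] from multinomials. *)
From HB Require Import structures.
From mathcomp Require Import all_boot all_order all_algebra.
From mathcomp Require Import generic_quotient boolp classical_sets.
From mathcomp Require Import monalg.

Set Implicit Arguments.
Unset Strict Implicit.
Unset Printing Implicit Defensive.

Import GRing.Theory.
Local Open Scope quotient_scope.
Local Open Scope classical_set_scope.
Local Open Scope ring_scope.

(* Ordinals start at 0: the letter a_k, 1 <= k <= n, is the ordinal i : 'I_n
   with [idx i = k]. *)
Definition idx n (i : 'I_n) : nat := i.+1.

Section ChineseMonoid.
Variable n : nat.

Inductive chinese_rel : seq 'I_n -> seq 'I_n -> Prop :=
| chinese_rel1 (i k j : 'I_n) : (idx i <= idx k <= idx j)%N ->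
    chinese_rel [:: j; i; k] [:: j; k; i]
| chinese_rel2 (i k j : 'I_n) : (idx i <= idx k <= idx j)%N ->
    chinese_rel [:: j; k; i] [:: k; j; i].

(* The monoid congruence on words generated by [chinese_rel]. *)
Inductive chinese_cong : seq 'I_n -> seq 'I_n -> Prop :=
| chinese_cong_rel u v : chinese_rel u v -> chinese_cong u v
| chinese_cong_refl u : chinese_cong u u
| chinese_cong_sym u v : chinese_cong u v -> chinese_cong v u
| chinese_cong_trans v u w :
    chinese_cong u v -> chinese_cong v w -> chinese_cong u w
| chinese_cong_cat u u' v v' :
    chinese_cong u u' -> chinese_cong v v' -> chinese_cong (u ++ v) (u' ++ v').

Definition chinese_congb (u v : seq 'I_n) : bool := `[< chinese_cong u v >].

Lemma chinese_congb_refl : reflexive chinese_congb.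
Proof. by move=> u; apply/asboolP; apply: chinese_cong_refl. Qed.

Lemma chinese_congb_sym : symmetric chinese_congb.
Proof. by move=> u v; apply/asboolP/asboolP; apply: chinese_cong_sym. Qed.

Lemma chinese_congb_trans : transitive chinese_congb.
Proof.
move=> v u w /asboolP uv /asboolP vw; apply/asboolP.
exact: chinese_cong_trans uv vw.
Qed.

Canonical chinese_equiv :=
  EquivRel chinese_congb chinese_congb_refl chinese_congb_sym
    chinese_congb_trans.

Definition chinese_monoid := {eq_quot chinese_equiv}.
HB.instance Definition _ := Choice.on chinese_monoid.

Definition chinese_of_word (w : seq 'I_n) : chinese_monoid :=
  \pi_chinese_monoid w.

Definition chinese_one : chinese_monoid := chinese_of_word [::].

Definition chinese_mul (x y : chinese_monoid) : chinese_monoid :=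
  chinese_of_word (repr x ++ repr y).

Lemma chinese_of_wordP u v :
  chinese_of_word u = chinese_of_word v <-> chinese_cong u v.
Proof.
split; first by move=> /eqmodP /asboolP.
by move=> h; apply/eqmodP/asboolP.
Qed.

Lemma chinese_of_word_cat u v :
  chinese_of_word (u ++ v) =
  chinese_mul (chinese_of_word u) (chinese_of_word v).
Proof.
apply/chinese_of_wordP; apply: chinese_cong_cat;
  by apply/chinese_of_wordP; rewrite /chinese_of_word reprK.
Qed.

Lemma chinese_wordE (x : chinese_monoid) : exists w, x = chinese_of_word w.
Proof. by exists (repr x); rewrite /chinese_of_word reprK. Qed.

Lemma chinese_mulA : associative chinese_mul.
Proof.
move=> x y z; have [u ->] := chinese_wordE x; have [v ->] := chinese_wordE y.
have [w ->] := chinese_wordE z.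
by rewrite -!chinese_of_word_cat catA.
Qed.

Lemma chinese_mul1m : left_id chinese_one chinese_mul.
Proof.
by move=> x; have [u ->] := chinese_wordE x; rewrite -chinese_of_word_cat.
Qed.

Lemma chinese_mulm1 : right_id chinese_one chinese_mul.
Proof.
move=> x; have [u ->] := chinese_wordE x.
by rewrite -chinese_of_word_cat cats0.
Qed.

Lemma chinese_cong_size u v : chinese_cong u v -> size u = size v.
Proof.
elim=> {u v} [u v []//|//|u v _ ->//|v u w _ -> _ ->//|u u' v v' _ eu _ ev].
by rewrite !size_cat eu ev.
Qed.

Lemma chinese_unitm x y :
  chinese_mul x y = chinese_one -> x = chinese_one /\ y = chinese_one.
Proof.
have [u ->] := chinese_wordE x; have [v ->] := chinese_wordE y.
rewrite -chinese_of_word_cat => /chinese_of_wordP /chinese_cong_size /=.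
by case: u v => [|? ?] [|? ?].
Qed.

HB.instance Definition _ := Choice_isMonomialDef.Build chinese_monoid
  chinese_mulA chinese_mul1m chinese_mulm1 chinese_unitm.

End ChineseMonoid.

Definition chinese_gen (K : fieldType) n (i : 'I_n) :
    {malg K[chinese_monoid n]} :=
  << chinese_of_word [:: i] >>.

Section Ideals.
Variable A : pzRingType.

Definition is_ideal (I : set A) : Prop :=
  [/\ I 0, (forall x y, I x -> I y -> I (x + y)),
      (forall r x, I x -> I (r * x)) & (forall r x, I x -> I (x * r))].

Definition ideal_gen (G : set A) : set A := smallest is_ideal G.

(* Prime in the noncommutative sense: I J `<=` P forces I `<=` P or J `<=` P.
   As P is closed under addition, it contains the product ideal I J iff it
   contains every product of an element of I by an element of J. *)
Definition prime_ideal (P : set A) : Prop :=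
  [/\ is_ideal P, P <> setT &
      forall I J : set A, is_ideal I -> is_ideal J ->
        [set x * y | x in I & y in J] `<=` P -> I `<=` P \/ J `<=` P].

End Ideals.

Section HeartDiamond.
Variables (K : fieldType) (n : nat).
Local Notation a := (@chinese_gen K n).

Inductive heart_generator (s : nat) : set {malg K[chinese_monoid n]} :=
| heart_upper (m i : 'I_n) : (s <= idx m)%N -> (s <= idx i)%N ->
    heart_generator s (a m * a i - a i * a m)
| heart_lower (l m : 'I_n) : (idx l <= s)%N -> (idx m <= s)%N ->
    heart_generator s (a l * a m - a m * a l).

Definition heart_ideal (s : nat) : set {malg K[chinese_monoid n]} :=
  ideal_gen (heart_generator s).

(* In the ternary generators, p is the ordinal denoting the letter a_(s-1),
   and q the one denoting a_s. *)
Inductive diamond_generator (s : nat) : set {malg K[chinese_monoid n]} :=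
| diamond_upper2 (m i : 'I_n) : (s <= idx m)%N -> (s <= idx i)%N ->
    diamond_generator s (a m * a i - a i * a m)
| diamond_upper3 (m i p : 'I_n) : (s <= idx m)%N -> (s <= idx i)%N ->
    idx p = (s - 1)%N ->
    diamond_generator s (a i * a p * a m - a m * a p * a i)
| diamond_lower2 (l m : 'I_n) : (idx l <= s - 1)%N -> (idx m <= s - 1)%N ->
    diamond_generator s (a l * a m - a m * a l)
| diamond_lower3 (l m q : 'I_n) : (idx l <= s - 1)%N -> (idx m <= s - 1)%N ->
    idx q = s ->
    diamond_generator s (a l * a q * a m - a m * a q * a l).

Definition diamond_ideal (s : nat) : set {malg K[chinese_monoid n]} :=
  ideal_gen (diamond_generator s).

End HeartDiamond.

Arguments heart_ideal K n s : clear implicits.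
Arguments diamond_ideal K n s : clear implicits.

(* Main.v *)
(* Write E_lk = [a_l, a_k] with k < l.  The relations say that E_lk kills every
   letter a_t, t <= k, on its right, and that a_r a_t commutes with the letters
   between t and r.  In a product E_lk w z, the first letter a_t of w with
   t <= k can be absorbed into a pair a_r a_t with r > k, and
   E_lk a_r a_t = a_j a_t E_l'k with l' > k, so this pair leaves the product on
   the left.  Hence E_lk K[M] z = 0 as soon as E_lk u z = 0 for all l > k and all
   words u in the letters above k, which is easily checked for z = [a_i, a_j]
   with i, j <= k, and for z = a_i a_(k+1) a_j - a_j a_(k+1) a_i with i, j <= k.
   Modulo a prime ideal one of the two factors vanishes.  So any two pairs of
   noncommuting letters overlap as intervals, which yields the threshold s, and
   in the diamond case the surviving commutators force the ternary relations
   (for one half of them, through the anti-automorphism reversing words and the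
   order of the letters). *)
Require Import Defs.
From mathcomp Require Import all_boot all_order all_algebra.
From mathcomp Require Import boolp classical_sets monalg.

Set Implicit Arguments.
Unset Strict Implicit.
Unset Printing Implicit Defensive.

Import GRing.Theory.
Local Open Scope classical_set_scope.
Local Open Scope ring_scope.

(** * Consequences of the Chinese relations in an arbitrary ring *)

(** Ring and order are left arbitrary so that the results also apply to the opposite ring with the
    reversed order. *)
Definition chinese_family (R : pzRingType) (T : Type) (le : rel T) (x : T -> R) :=
  forall i k j, le i k -> le k j ->
    x j * x i * x k = x j * x k * x i /\ x j * x k * x i = x k * x j * x i.

Section ChineseFamily.
Variables (R : pzRingType) (T : Type) (le : rel T) (x : T -> R).
Hypotheses (le_total : total le) (le_trans : transitive le).
Hypothesis xP : chinese_family le x.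

Local Notation word w := (\prod_(i <- w) x i).
Local Notation comm l k := (x l * x k - x k * x l).

Let ltW k l : ~~ le l k -> le k l.
Proof. by move=> h; move: (le_total k l); rewrite (negbTE h) orbF. Qed.

Lemma low_swap t l k : le t l -> le t k -> x l * x k * x t = x k * x l * x t.
Proof.
move=> tl tk; case/orP: (le_total l k) => h; first by have [_ ->] := xP tl h.
by have [_ ->] := xP tk h.
Qed.

Lemma high_swap t i k : le i t -> le k t -> x t * x i * x k = x t * x k * x i.
Proof.
move=> it kt; case/orP: (le_total i k) => h; first by have [-> _] := xP h kt.
by have [-> _] := xP h it.
Qed.

Lemma comm_mul_low t l k : le t l -> le t k -> comm l k * x t = 0.
Proof. by move=> tl tk; rewrite mulrBl (low_swap tl tk) subrr. Qed.

Lemma pair_commute t k j : le t k -> le k j -> GRing.comm (x j * x t) (x k).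
Proof. by move=> tk kj; rewrite /GRing.comm mulrA; have [-> ->] := xP tk kj. Qed.

Lemma pair_comm t l k j : le t l -> le l j -> le t k -> le k j ->
  GRing.comm (x j * x t) (comm l k).
Proof.
move=> tl lj tk kj; have cl := pair_commute tl lj; have ck := pair_commute tk kj.
by apply: commrB; apply: commrM.
Qed.

(** Induction on [v]: a further letter [x i] on the left commutes with [x r * x t] when [i] is below
    [r]; otherwise it takes the place of [x r], since [x i * x r * x t = x i * x t * x r]. *)
Lemma word_pair (p : pred T) t v : (forall i, p i -> le t i) ->
    all p v -> (0 < size v)%N ->
  exists r v', [/\ p r, word v * x t = x r * x t * word v'
    & (size v' < size v)%N].
Proof.
move=> pt; elim: v => [//|i v IHv] /= /andP[pi pv] _.
have [v0|v_gt0] := posnP (size v).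
  by exists i, [::]; rewrite (size0nil v0) !big_cons !big_nil !mulr1.
have [r [v' [pr vE lt_v']]] := IHv pv v_gt0.
rewrite big_cons -mulrA vE.
case/orP: (le_total i r) => ir.
  exists r, (i :: v'); rewrite big_cons; split => //.
  by rewrite !mulrA (pair_commute (pt _ pi) ir) !mulrA.
exists i, (r :: v'); rewrite big_cons; split => //.
rewrite !mulrA; congr (_ * _).
by have [-> _] := xP (pt _ pr) ir.
Qed.

(** If [l] is below [r], both [l] and [k] lie between [t] and [r], so the pair commutes with the
    commutator; otherwise [l] and [r] exchange roles. *)
Lemma comm_mul_pair t k l r : le t k -> ~~ le l k -> ~~ le r k ->
  exists j l', ~~ le l' k /\ comm l k * (x r * x t) = x j * x t * comm l' k.
Proof.
move=> tk kl kr; have tl := le_trans tk (ltW kl); have tr := le_trans tk (ltW kr).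
case/orP: (le_total l r) => lr.
  exists r, l; split => //; rewrite pair_comm //; exact: ltW.
exists l, r; split => //; rewrite (pair_comm tr lr tk (ltW kl)).
have klr : x l * x k * x r = x r * x l * x k.
  by have [_ <-] := xP (ltW kr) lr; have [-> _] := xP (ltW kr) lr.
rewrite !mulrBl !mulrA klr -(mulrA (x r)) -(mulrA (x r)).
rewrite (low_swap tl tk) !mulrA; congr (_ - _).
by rewrite -!(mulrA (x k)) (low_swap tl tr) !mulrA.
Qed.

Section CommWord.
Variables (k : T) (z : R).
Hypothesis comm_high : forall l u, ~~ le l k -> all (fun r => ~~ le r k) u ->
  comm l k * word u * z = 0.

Lemma comm_word_mul0 w l : ~~ le l k -> comm l k * word w * z = 0.
Proof.
(* The induction covers all [l] at once, since moving a pair out to the left replaces [l] by some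
   [l']. *)
have [m] := ubnP (size w); elim: m w l => // m IHm w l /ltnSE le_w kl.
have [has_low | no_low] := boolP (has (le^~ k) w); last first.
  by apply: comm_high; rewrite // all_predC.
case/split_find: has_low le_w => t v w' tk; rewrite -all_predC => v_high.
rewrite size_cat size_rcons -cats1 !big_cat big_seq1 /= !mulrA => lt_m.
have [/size0nil v0 | v_gt0] := posnP (size v).
  by rewrite v0 big_nil mulr1 comm_mul_low ?mul0r // (le_trans tk (ltW kl)).
have hi i : ~~ le i k -> le t i by move/ltW; apply: le_trans.
have [r [v' [kr vE lt_v']]] := word_pair hi v_high v_gt0.
have [j [l' [kl' E]]] := comm_mul_pair tk kl kr.
rewrite -(mulrA (comm l k) (word v)) vE (mulrA (comm l k)) E -!mulrA (mulrA (word v')).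
rewrite -big_cat /= (mulrA (comm l' k)) IHm ?mulr0 // size_cat.
by rewrite (leq_trans _ lt_m) // addSn ltnS leq_add2r ltnW.
Qed.
End CommWord.

(** For words above [k]: if the word is empty, [comm l k] kills [x i] and [x j]; otherwise its last
    letter is above [i] and [j] and kills [comm i j]. *)
Lemma comm_word_comm_mul0 i j k l w : le i k -> le j k -> ~~ le l k ->
  comm l k * word w * comm i j = 0.
Proof.
move=> ik jk; apply: comm_word_mul0 => {}l u kl.
have [il jl] := (le_trans ik (ltW kl), le_trans jk (ltW kl)).
case/lastP: u => [_ | u r].
  rewrite big_nil mulr1 mulrBr !mulrA.
  by rewrite !(comm_mul_low il ik, comm_mul_low jl jk) !mul0r subrr.
rewrite all_rcons => /andP[kr _]; rewrite -cats1 big_cat big_seq1 /= -!mulrA mulrBr !mulrA.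
rewrite (high_swap (le_trans ik (ltW kr)) (le_trans jk (ltW kr))).
by rewrite subrr !mulr0.
Qed.

(** As [s] is the least letter above [k], the last letter [r] of a nonempty word above [k] satisfies
    [le s r]. Hence [x r] lets [x s] move to the front, where [x s] makes [x i] and [x j]
    commute. *)
Lemma comm_word_ternary_mul0 i j k s l w : le i k -> le j k ->
    (forall r, ~~ le r k -> le s r) -> ~~ le s k -> ~~ le l k ->
  comm l k * word w * (x i * x s * x j - x j * x s * x i) = 0.
Proof.
move=> ik jk s_min ks; apply: comm_word_mul0 => {}l u kl.
have [il jl] := (le_trans ik (ltW kl), le_trans jk (ltW kl)).
have [is_ js] := (le_trans ik (ltW ks), le_trans jk (ltW ks)).
case/lastP: u => [_ | u r].
  rewrite big_nil mulr1 mulrBr !mulrA.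
  by rewrite !(comm_mul_low il ik, comm_mul_low jl jk) !mul0r subrr.
rewrite all_rcons => /andP[kr _]; rewrite -cats1 big_cat big_seq1 /= -!mulrA mulrBr !mulrA.
have [ir jr] := (le_trans ik (ltW kr), le_trans jk (ltW kr)).
rewrite (high_swap ir (s_min _ kr)) (high_swap jr (s_min _ kr)).
rewrite -!(mulrA (x r)) (high_swap is_ js).
by rewrite subrr !mulr0.
Qed.
End ChineseFamily.

(** * Reversal of words and of the order *)

(** Reading words backwards and reversing the order exchanges the two Chinese relations. *)
Lemma chinese_family_converse (R : pzRingType) (T : Type) (le : rel T)
    (x : T -> R) :
  chinese_family le x -> chinese_family (fun i j => le j i) (x : T -> R^c).
Proof.
move=> xP i k j ki jk; have [e1 e2] := xP _ _ _ jk ki.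
by split; [change (x k * (x i * x j) = x i * (x k * x j))
  |change (x i * (x k * x j) = x i * (x j * x k))]; rewrite !mulrA.
Qed.

Lemma prod_converse (R : pzRingType) (T : Type) (x : T -> R) (w : seq T) :
  \prod_(i <- w) (x i : R^c) = \prod_(i <- rev w) x i.
Proof.
elim: w => [|i w IHw]; first by rewrite !big_nil.
by rewrite rev_cons big_cons -cats1 big_cat big_seq1 /= IHw.
Qed.

Lemma ternary_word_comm_mul0 (R : pzRingType) (T : Type) (le : rel T)
    (x : T -> R) (le_total : total le) (le_trans : transitive le)
    (xP : chinese_family le x) i j k s l w :
    le k i -> le k j -> (forall r, ~~ le k r -> le r s) ->
    ~~ le k s -> ~~ le k l ->
  (x i * x s * x j - x j * x s * x i) * \prod_(i <- w) x i *
    (x k * x l - x l * x k) = 0.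
Proof.
move=> ki kj s_max ks kl.
have tot : total (fun i j => le j i) by move=> a b; apply: le_total.
have tr : transitive (fun i j => le j i).
  by move=> a b c ba ac; apply: le_trans ac ba.
(* The word is reversed and [i], [j] are swapped beforehand, to undo the reversal caused by
   [R^c]. *)
have := comm_word_ternary_mul0 tot tr (chinese_family_converse xP)
  (rev w) kj ki s_max ks kl.
rewrite prod_converse revK => E.
rewrite -mulrA -!(mulrA (x i)) -!(mulrA (x j)); exact: E.
Qed.

(** * Primality tested on elements *)

Section Ideals.
Variable A : pzRingType.
Implicit Types P I : set A.

Lemma is_ideal_opp I a : is_ideal I -> I a -> I (- a).
Proof. by case=> _ _ Ml _ Ia; rewrite -mulN1r; apply: Ml. Qed.

(** With [A] the ring, the ideals [J] of all [b] with [y A b] in [P], and [I] of all [a] with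
    [a A J] in [P], have [I J] in [P], while [y] is in [I] and [z] in [J]. *)
Lemma prime_ideal_mul P : prime_ideal P ->
  forall y z, (forall r, P (y * r * z)) -> P y \/ P z.
Proof.
case=> -[P0 PD PMl PMr] _ Pprime y z Pyz.
pose J := [set b | forall r, P (y * r * b)].
pose I := [set a | forall r b, J b -> P (a * r * b)].
have [|||/(_ y)|/(_ z)] := Pprime I J.
- split=> [r b _|a a' Ia Ia' r b Jb|s a Ia r b Jb|s a Ia r b Jb].
  + by rewrite !mul0r.
  + by rewrite !mulrDl; apply: PD; [apply: Ia|apply: Ia'].
  + by rewrite -!mulrA; apply: PMl; rewrite mulrA; apply: Ia.
  + by rewrite -(mulrA a); apply: Ia.
- split=> [r|b b' Jb Jb' r|s b Jb r|s b Jb r].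
  + by rewrite mulr0.
  + by rewrite mulrDr; apply: PD; [apply: Jb|apply: Jb'].
  + by rewrite mulrA -(mulrA y); apply: Jb.
  + by rewrite mulrA; apply: PMr.
- by move=> _ [a Ia [b Jb <-]]; rewrite -[a]mulr1; apply: Ia.
- by move=> IP; left; apply: IP => r b; apply.
- by move=> JP; right; apply: JP.
Qed.

Lemma ideal_gen_sub P (G : set A) : is_ideal P -> G `<=` P -> ideal_gen G `<=` P.
Proof. by move=> idP GP a; apply; split. Qed.
End Ideals.

(** * Words in the monoid algebra *)

Section ChineseAlgebra.
Variables (K : fieldType) (n : nat).
Local Notation A := {malg K[chinese_monoid n]}.
Local Notation a := (@chinese_gen K n).

Lemma monalg_word (w : seq 'I_n) :
  << chinese_of_word w >> = \prod_(i <- w) a i :> A.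
Proof.
elim: w => [|i w IHw]; first by rewrite big_nil.
rewrite big_cons -IHw malgM_def fgmulUU mulr1 -cat1s.
by congr (<< _ >>); rewrite chinese_of_word_cat.
Qed.

(** Constants are central: [K] is commutative and they are supported on the neutral monomial. *)
Lemma monalg_mulCA (c : K) (y g : A) : y * (c *: g) = c *: (y * g).
Proof.
rewrite -!mul_malgC !mulrA; congr (_ * _).
rewrite !malgM_def fgmulgU fgmulUg; apply: eq_bigr => k _.
by rewrite mulrC (mulm1 k) mul1m.
Qed.

(** The words span the algebra over [K]. *)
Lemma mul_words_eq0 (y z : A) :
  (forall w, y * \prod_(i <- w) a i * z = 0) -> forall r, y * r * z = 0.
Proof.
move=> yz0 r; rewrite (monalgE r) mulr_sumr mulr_suml big1 // => m _.
have [w ->] := chinese_wordE m; set c := r@__.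
have -> : << c *g chinese_of_word w >> = c *: \prod_(i <- w) a i :> A.
  rewrite -monalg_word -mul_malgC malgM_def fgmulUU mulr1.
  by congr (<< _ *g _ >>); rewrite mul1m.
by rewrite monalg_mulCA -scalerAl yz0 scaler0.
Qed.

Lemma chinese_family_gen : chinese_family (fun i j : 'I_n => (i <= j)%N) a.
Proof.
move=> i k j ik kj; have h : (idx i <= idx k <= idx j)%N by rewrite !ltnS ik.
have E u v w : a u * a v * a w = << chinese_of_word [:: u; v; w] >>.
  by rewrite monalg_word !big_cons big_nil mulr1 mulrA.
rewrite !E; split; congr (<< _ >>); apply/chinese_of_wordP/chinese_cong_rel.
  exact: chinese_rel1.
exact: chinese_rel2.
Qed.
End ChineseAlgebra.

(* The threshold is the least letter q whose predecessors, together with q, do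
   not commute pairwise. *)
Lemma commuting_threshold (n : nat) (c : rel 'I_n) : (3 <= n)%N ->
    reflexive c -> symmetric c ->
    (forall i j k l : 'I_n, (i <= k)%N -> (j <= k)%N -> (k < l)%N ->
      c k l || c i j) ->
  (exists s, [/\ (2 <= s <= n - 1)%N,
     forall i j, (s <= idx i)%N -> (s <= idx j)%N -> c i j &
     forall i j, (idx i <= s)%N -> (idx j <= s)%N -> c i j]) \/
  (exists p q : 'I_n, [/\ idx q = (idx p).+1,
     forall i j : 'I_n, (q <= i)%N -> (q <= j)%N -> c i j,
     forall i j : 'I_n, (i <= p)%N -> (j <= p)%N -> c i j,
     exists2 i : 'I_n, (i < q)%N & ~~ c q i &
     exists2 l : 'I_n, (p < l)%N & ~~ c l p]).
Proof.
move=> n_ge3 c_refl c_sym c_overlap.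
pose Q m := [exists i : 'I_n, exists j : 'I_n,
  [&& (i <= m)%N, (j <= m)%N & ~~ c i j]].
have QP m : reflect (exists i j : 'I_n, [/\ (i <= m)%N, (j <= m)%N & ~~ c i j])
    (Q m).
  apply: (iffP existsP) => [[i /existsP[j /and3P[]]]|[i [j [im jm nc]]]].
    by exists i, j.
  by exists i; apply/existsP; exists j; rewrite im jm.
have [exQ | noQ] := pselect (exists m, Q m); last first.
  have c_all i j : c i j.
    apply: contrapT => /negP nc; apply: noQ; exists n; apply/QP.
    by exists i, j; split=> //; apply: ltnW.
  (* All letters commute, so any threshold works; [2] is in range because [3 <= n]. *)
  left; exists 2; split=> //.
  by rewrite /= subn1 -ltnS (ltn_predK n_ge3).
case: (ex_minnP exQ) => J /QP[i0 [j0 [i0J j0J nc0]]] Jmin.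
have low (i j : 'I_n) : (i < J)%N -> (j < J)%N -> c i j.
  case: J Jmin {i0J j0J} => // J Jmin iJ jJ; apply: contraT => nc.
  suff /Jmin : Q J by rewrite ltnn.
  by apply/QP; exists i, j.
(* By minimality one letter of a noncommuting pair is [J] itself, and by reflexivity the other is
   strictly below. *)
have {i0 j0 i0J j0J nc0} [q [i [qJ iJ nc]]] :
    exists q i : 'I_n, [/\ q = J :> nat, (i < J)%N & ~~ c q i].
  move: i0J j0J; rewrite leq_eqVlt => /predU1P[i0J|i0J].
    rewrite leq_eqVlt => /predU1P[j0J|j0J]; last by exists i0, j0.
    by move: nc0; rewrite (_ : i0 = j0) ?c_refl //; apply: ord_inj; rewrite i0J.
  rewrite leq_eqVlt => /predU1P[j0J|j0J]; first by exists j0, i0; rewrite c_sym.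
  by rewrite low in nc0.
move: J qJ iJ low {exQ Jmin} => _ <- iq low.
have high (k l : 'I_n) : (q <= k)%N -> (q <= l)%N -> c k l.
  wlog kl : k l / (k < l)%N => [wlog_kl qk ql|qk _].
    case: (ltngtP k l) => kl; [exact: wlog_kl | by rewrite c_sym wlog_kl |].
    by rewrite (val_inj kl).
  have := c_overlap q i k l qk (leq_trans (ltnW iq) qk) kl.
  by rewrite (negbTE nc) orbF.
have q_gt0 : (0 < q)%N by apply: leq_ltn_trans iq.
have pn : (q.-1 < n)%N by apply: leq_ltn_trans (ltn_ord q); apply: leq_pred.
pose p := Ordinal pn; have qp : q = p.+1 :> nat by rewrite /= prednK.
(* The diamond case arises when the predecessor [p] of [q] fails to commute with some letter above
   it. *)
have [[l pl ncl] | no_l] := pselect (exists2 l : 'I_n, (p < l)%N & ~~ c l p).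
  right; exists p, q; split=> //; [by rewrite /idx -qp | | by exists i | by exists l].
  by move=> j k jp kp; apply: low; rewrite qp ltnS.
have c_p (r : 'I_n) : (p <= r)%N -> c p r.
  rewrite leq_eqVlt => /predU1P[/val_inj<- //|pr].
  by rewrite c_sym; apply: contraT => ncr; case: no_l; exists r.
have c_high (k l : 'I_n) : (p <= k)%N -> (p <= l)%N -> c k l.
  move=> pk pl; move: (pk); rewrite leq_eqVlt => /predU1P[/val_inj<-|pk'].
    exact: c_p.
  move: (pl); rewrite leq_eqVlt => /predU1P[/val_inj<-|pl'].
    by rewrite c_sym c_p.
  by apply: high; rewrite qp.
(* As a number, [q] equals [idx p], so the heart threshold is the letter [p]. If [q] were 1, then
   [p] would be 0 and all letters would commute, contradicting [nc]. *)
left; exists q; split=> [|k l|k l]; last exact: low.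
  rewrite subn1 -[(q <= _)%N]ltnS (ltn_predK n_ge3) ltn_ord andbT ltn_neqAle q_gt0.
  rewrite andbT; apply/eqP => q1; case/negP: nc; apply: c_high.
    by rewrite /= leq_pred.
  by rewrite /= -q1.
by rewrite qp !ltnS; apply: c_high.
Qed.

(** * Application to prime ideals *)

Lemma commuting_letters_mod_prime (R : pzRingType) (n : nat) (x : 'I_n -> R)
    (P : set R) :
    (3 <= n)%N -> chinese_family (fun i j : 'I_n => (i <= j)%N) x ->
    is_ideal P ->
    (forall y z, (forall w, y * \prod_(i <- w) x i * z = 0) -> P y \/ P z) ->
  let comm i j := x i * x j - x j * x i in
  let ternary i p j := x i * x p * x j - x j * x p * x i in
  (exists s, [/\ (2 <= s <= n - 1)%N,
     forall i j, (s <= idx i)%N -> (s <= idx j)%N -> P (comm i j) &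
     forall i j, (idx i <= s)%N -> (idx j <= s)%N -> P (comm i j)]) \/
  (exists p q : 'I_n, [/\ idx q = (idx p).+1,
     forall i j : 'I_n, (q <= i)%N -> (q <= j)%N -> P (comm i j),
     forall i j : 'I_n, (q <= i)%N -> (q <= j)%N -> P (ternary i p j),
     forall i j : 'I_n, (i <= p)%N -> (j <= p)%N -> P (comm i j) &
     forall i j : 'I_n, (i <= p)%N -> (j <= p)%N -> P (ternary i q j)]).
Proof.
move=> n_ge3 xP idP P_words comm ternary.
have tot : total (fun i j : 'I_n => (i <= j)%N) by move=> i j; apply: leq_total.
have tr : transitive (fun i j : 'I_n => (i <= j)%N).
  by move=> j i k; apply: leq_trans.
pose c i j := `[< P (comm i j) >].
have cP i j : c i j -> P (comm i j) by move/asboolP.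
have c_refl : reflexive c.
  by move=> i; apply/asboolP; rewrite /comm subrr; case: idP.
have c_sym : symmetric c.
  by move=> i j; apply/asboolP/asboolP => /(is_ideal_opp idP); rewrite opprB.
case: (commuting_threshold n_ge3 c_refl c_sym) => [i j k l ik jk kl | |].
- have [|Pkl|Pij] := P_words (comm l k) (comm i j).
  + by move=> w; apply: (comm_word_comm_mul0 tot tr xP); rewrite -?ltnNge.
  + by rewrite c_sym; apply/orP; left; apply/asboolP.
  + by apply/orP; right; apply/asboolP.
- by move=> [s [s_range up low]]; left; exists s; split=> // i j si sj; apply: cP; auto.
move=> [p [q [qp up low [i iq nci] [l pl ncl]]]]; right; exists p, q.
have {}qp : q = p.+1 :> nat by case: qp.
rewrite qp in iq.
split=> [|j k qj qk|j k qj qk|j k jp kp|j k jp kp].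
- by rewrite /idx qp.
- by apply: cP; apply: up.
(* The surviving commutator of [q] and [i] is outside [P], so its vanishing products with the
   ternary element force the latter into [P]. *)
- have [w| // |Pqi] := P_words (ternary j p k) (comm q i).
    apply: (ternary_word_comm_mul0 tot tr xP) => // [r||]; rewrite -ltnNge ?qp //.
  by case/asboolPn: nci.
- by apply: cP; apply: low.
- have [w|Plp| //] := P_words (comm l p) (ternary j q k).
    apply: (comm_word_ternary_mul0 tot tr xP) => // [r||]; rewrite -ltnNge ?qp //.
  by case/asboolPn: ncl.
Qed.

Theorem theorem1p1p4 (K : fieldType) (n : nat) (hn : (3 <= n)%N)
    (P : set {malg K[chinese_monoid n]}) (hP : prime_ideal P) :
  (exists2 s : nat, (2 <= s <= n - 1)%N & heart_ideal K n s `<=` P) \/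
  (exists2 s : nat, (2 <= s <= n)%N & diamond_ideal K n s `<=` P).
Proof.
have idP : is_ideal P by case: hP.
case: (commuting_letters_mod_prime hn (@chinese_family_gen K n) idP).
- move=> y z yz0; apply: prime_ideal_mul => // r.
  by rewrite mul_words_eq0 //; case: idP.
- move=> [s [s_range up low]]; left; exists s => //.
  by apply: ideal_gen_sub => // _ [m i|l m]; [apply: up | apply: low].
move=> [p [q [qp up2 up3 low2 low3]]]; right; exists (idx q).
  by apply/andP; split; [rewrite qp | apply: ltn_ord].
(* The middle letters of the ternary generators are given by their index only; they are identified
   with [p] and [q]. *)
have p_idx (r : 'I_n) : idx r = (idx q - 1)%N -> r = p.
  by rewrite qp subn1 => -[/ord_inj].
have q_idx (r : 'I_n) : idx r = idx q -> r = q by case=> /ord_inj.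
have le_p (r : 'I_n) : (idx r <= idx q - 1)%N = (r <= p)%N by rewrite qp subn1.
apply: ideal_gen_sub => // _ [m i|m i r qm qi /p_idx->|l m|l m r].
- exact: up2.
- exact: up3.
- by rewrite !le_p; apply: low2.
- by rewrite !le_p => lp mp /q_idx->; apply: low3.
Qed.
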